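(* Let $T$ be a finite tree, let $\ell$ be an integer with $1\le\ell\le |V(T)|$, and let $B$ be the set of vertices of $T$ with degree at most $\ell$. Then $\mathrm{Z}_{(\ell)}(T)=|B|$.
   Context: Zero forcing color change rule: a blue vertex $u$ may force (color blue) a white vertex $v$ if $v$ is the only white neighbor of $u$. A leak is a vertex that is not allowed to perform a force. For an integer $0\le \ell\le |V(G)|$, a set $B\subseteq V(G)$ is an $\ell$-leaky forcing set of a graph $G$ if, for every set $L\subseteq V(G)$ with $|L|=\ell$, starting with exactly $B$ blue (all others white) and iteratively applying the color change rule, with vertices of $L$ not allowed to force, eventually colors all of $V(G)$ blue. $\mathrm{Z}_{(\ell)}(G)$ is the minimum size of an $\ell$-leaky forcing set of $G$. *)

(* Defs.v *)
From mathcomp Require Import all_boot.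
Set Implicit Arguments.
Unset Strict Implicit.
Unset Printing Implicit Defensive.

Section Graph.

Variables (V : finType) (e : rel V).

Definition simple_graph : Prop := symmetric e /\ irreflexive e.

Definition connected_graph : Prop := forall x y : V, connect e x y.

(* [ucycle] also accepts the back-and-forth walk [:: x; y] along an edge, so
   graph cycles are the [ucycle]s with at least three vertices. *)
Definition acyclic_graph : Prop :=
  forall c : seq V, 2 < size c -> ~ ucycle e c.

Definition tree : Prop :=
  [/\ simple_graph, connected_graph & acyclic_graph].

Definition degree (v : V) : nat := #|[set w | e v w]|.

(* Blue set S, leaks L: u may force v. *)
Definition can_force (L S : {set V}) (u v : V) : bool :=
  [&& u \in S, u \notin L & [set w | e u w] :\: S == [set v]].

Definition force_step (L : {set V}) : rel {set V} :=
  fun S S' => [exists u, exists v, can_force L S u v && (S' == v |: S)].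

Definition colors_all (L B : {set V}) : bool :=
  connect (force_step L) B [set: V].

Definition leaky_forcing_set (l : nat) (B : {set V}) : bool :=
  [forall L : {set V}, (#|L| == l) ==> colors_all L B].

Lemma leaky_forcing_setT (l : nat) : leaky_forcing_set l [set: V].
Proof. by apply/forallP => L; apply/implyP => _; exact: connect0. Qed.

(* The default value of this [arg min] is never used, by [leaky_forcing_setT]. *)
Definition leaky_forcing_number (l : nat) : nat :=
  #|[arg min_(B < [set: V] | leaky_forcing_set l B) #|B|]|.

End Graph.

(* Main.v *)
(** Lower bound: when [degree v <= l], the leaks can cover all neighbours of
    [v], so nothing ever forces [v].

    Upper bound: suppose the process started from [B] stops at [S] with a vertex
    [w] still white.  Every white vertex has degree greater than [l >= 1].  Walk
    from [w] into one of its branches without backtracking: a white vertex has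
    another neighbour, and a blue vertex entered from a white one is a leak or
    has another white neighbour, since otherwise it would force.  The tree being
    finite and acyclic, the walk meets a leak.  So each of the more than [l]
    branches at [w] contains a leak, and these are distinct. *)

Require Import Defs.
From mathcomp Require Import all_boot.

Set Implicit Arguments.
Unset Strict Implicit.
Unset Printing Implicit Defensive.

(** Its [connect] classes on the vertices other than [w] are the branches at [w]. *)
Definition avoiding (V : finType) (e : rel V) (w x y : V) : bool :=
  [&& x != w, y != w & e x y].
Arguments avoiding V e w x y /.

Lemma connect_avoiding_sym (V : finType) (e : rel V) (w : V) :
  symmetric e -> connect_sym (avoiding e w).
Proof.
by move=> se; apply: sym_connect_sym => x y /=; rewrite se andbCA.
Qed.

Lemma avoiding_path_connect (V : finType) (e : rel V) (w x y : V) (p : seq V) :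
  path e x p -> w \notin x :: p -> y \in x :: p -> connect (avoiding e w) x y.
Proof.
elim: p x => [|z p IHp] x /=; first by move=> _ _; rewrite inE => /eqP ->.
case/andP=> exz pzp; rewrite !inE !negb_or => /and3P[wx wz wp].
case/predU1P=> [-> //|yzp]; apply: (@connect_trans _ _ z).
  by apply: connect1; rewrite /= eq_sym wx eq_sym wz.
by apply: IHp => //; rewrite inE negb_or wz.
Qed.

(** A path from [x] to [y] off [w], made duplicate-free, would close up through [w] into a cycle. So
    distinct neighbours of [w] lie in distinct branches. *)
Lemma acyclic_branch_inj (V : finType) (e : rel V) (w x y : V) :
  symmetric e -> acyclic_graph e -> e w x -> e w y ->
  connect (avoiding e w) x y -> x = y.
Proof.
move=> se ae ewx ewy /connectP[p0 pp0 Dy]; rewrite {}Dy in ewy *.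
case/shortenP: pp0 ewy => -[//|z p] pp up _ ewy.
case: (ae [:: w, x, z & p]) => //; apply/andP; split.
  have pe : path e x (z :: p) by apply: sub_path pp => s t /and3P[].
  by rewrite /cycle rcons_path se ewy andbT; apply/andP.
rewrite cons_uniq up andbT; apply/negP=> wp.
have : all (fun t => t != w) (x :: z :: p).
  have /andP[/and3P[xw _ _] _] := pp.
  move: (z :: p) pp => q; rewrite /= xw /=.
  elim: q x {xw up ewx ewy wp} => //= t q IHq x.
  by case/andP=> /and3P[_ -> _] /IHq.
by move/allP=> /(_ w wp); rewrite eqxx.
Qed.

(** If [z] were on the old path, it would lie in the same branch at [y] as [x]. *)
Lemma acyclic_path_extend (V : finType) (e : rel V) (x y z : V) (p : seq V) :
  symmetric e -> irreflexive e -> acyclic_graph e ->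
  path e y (x :: p) -> uniq (y :: x :: p) -> e y z -> z != x ->
  uniq (z :: y :: x :: p).
Proof.
move=> se ie ae /=/andP[eyx pxp] /andP[ynp up] eyz zx.
rewrite ynp up !andbT inE negb_or.
have -> /= : z != y by apply: contraTneq eyz => ->; rewrite ie.
apply: contraNN zx => zp; apply/eqP/esym.
exact: (acyclic_branch_inj se ae eyx eyz (avoiding_path_connect pxp ynp zp)).
Qed.

Section Stalled.

Variables (V : finType) (e : rel V) (L S : {set V}).
Hypotheses (se : symmetric e) (ie : irreflexive e) (ae : acyclic_graph e).
Hypothesis stalled : forall u v, ~~ can_force e L S u v.
Hypothesis white_degree : forall v, v \notin S -> 1 < degree e v.

Lemma white_next (x y : V) : y \notin S -> exists2 z, e y z & z != x.
Proof.
move=> /white_degree/card_gt1P[a [b []]]; rewrite !inE => ea eb ab.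
have [ax|] := eqVneq a x; last by exists a.
by exists b => //; rewrite eq_sym -ax.
Qed.

Lemma blue_next (x y : V) : y \in S -> y \notin L -> x \notin S -> e y x ->
  exists z, [/\ e y z, z != x & z \notin S].
Proof.
move=> yS yL xS eyx; have := stalled y x.
rewrite /can_force yS yL /= eqEsubset sub1set !inE xS eyx /= andbT.
case/subsetPn=> z.
by rewrite !inE => /andP[zS eyz] zx; exists z.
Qed.

(* [y :: x :: p] is the walk so far, most recent vertex first. *)
Lemma walk_meets_leak (x y : V) (p : seq V) :
  path e y (x :: p) -> uniq (y :: x :: p) -> x \notin S ->
  exists2 t, t \in L & connect (avoiding e (last x p)) y t.
Proof.
(* The walk never repeats a vertex, so the number of vertices left bounds its further growth. *)
have [n] := ubnP (#|V| - size p); elim: n x y p => // n IHn x y p ltn pp up xS.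
have [yL|yL] := boolP (y \in L); first by exists y.
have fit (q : seq V) : uniq q -> size q <= #|V|.
  by move=> /card_uniqP <-; exact: max_card.
(* The origin [last x p] is already behind [a], so a fresh edge out of [a] avoids it. *)
have step z a q : uniq (z :: a :: q) -> last x p \in q -> e a z ->
    connect (avoiding e (last x p)) a z.
  move=> /=/and3P[zn an _] wq eaz; apply: connect1; rewrite /= eaz andbT.
  apply/andP; split; first by apply: contraNneq an => ->.
  by apply: contraNneq zn => ->; rewrite inE wq orbT.
have wp : last x p \in x :: p by exact: mem_last.
have [yS|yS] := boolP (y \in S); last first.
  have [z eyz zx] := white_next x yS.
  have uz := acyclic_path_extend se ie ae pp up eyz zx.
  have [||||t tL ct] := IHn y z (x :: p); rewrite ?uz //.
  - by have := fit _ uz; move: ltn => /=; rewrite !ltnS => ltn lep;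
      apply: leq_trans ltn; rewrite ltn_sub2l // ltnW // ltnW.
  - by rewrite /= se eyz.
  by exists t => //; apply: connect_trans ct; exact: (step _ _ _ uz).
have eyx : e y x by case/andP: pp.
have [z [eyz zx zS]] := blue_next yS yL xS eyx.
have uz := acyclic_path_extend se ie ae pp up eyz zx.
have pz : path e z (y :: x :: p) by rewrite /= se eyz.
(* From a blue [y] the walk advances twice, to [z] and then [a]: the induction needs the vertex
   before the head to be white, and [z] is. *)
have [a eza ay] := white_next y zS.
have ua := acyclic_path_extend se ie ae pz uz eza ay.
have [||||t tL ct] := IHn z a (y :: x :: p); rewrite ?ua //.
- have := fit _ ua; move: ltn => /=; rewrite !ltnS => ltn lep.
  apply: leq_trans ltn; apply: (@leq_ltn_trans (#|V| - (size p).+1)).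
    exact: leq_sub2l.
  by rewrite ltn_sub2l // ltnW // ltnW // ltnW.
- by rewrite [path _ _ _]/(e a z && path e z (y :: x :: p)) se eza.
exists t => //; apply: connect_trans (step _ _ _ uz wp eyz) _.
apply: connect_trans ct; apply: (step _ _ _ ua) => //.
by rewrite inE wp orbT.
Qed.

Lemma white_degree_le_leaks (w : V) : w \notin S -> degree e w <= #|L|.
Proof.
move=> wS; pose leak u t := (t \in L) && connect (avoiding e w) u t.
have leakP u : e w u -> exists t, leak u t.
  move=> ewu; have [||t tL ct] := @walk_meets_leak w u [::] _ _ wS.
  - by rewrite /= se ewu.
  - by rewrite /= inE andbT; apply: contraTneq ewu => ->; rewrite ie.
  by exists t; rewrite /leak tL.
pose f u := odflt w [pick t | leak u t].
have fP u : e w u -> leak u (f u).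
  by rewrite /f => /leakP[t ut]; case: pickP => [//|/(_ t)]; rewrite ut.
rewrite /degree -(@card_in_imset _ _ f) => [|u v].
  apply: subset_leq_card; apply/subsetP=> _ /imsetP[u + ->].
  by rewrite inE => /fP/andP[].
(* A common leak would put [u] and [v] in one branch at [w]. *)
rewrite !inE => ewu ewv fuv; apply: (acyclic_branch_inj se ae ewu ewv).
have /andP[_ cu] := fP u ewu; have /andP[_ cv] := fP v ewv.
by apply: connect_trans cu _; rewrite fuv connect_avoiding_sym.
Qed.

End Stalled.

Lemma low_degree_leaky_forcing_set (V : finType) (e : rel V) (l : nat) :
  symmetric e -> irreflexive e -> acyclic_graph e -> 0 < l ->
  leaky_forcing_set e l [set v | degree e v <= l].
Proof.
move=> se ie ae l_gt0; set B := [set v | _].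
apply/forallP=> L; apply/implyP=> /eqP cL; rewrite /colors_all.
pose reach S := connect (force_step e L) B S && (B \subset S).
have rB : reach B by rewrite /reach connect0 subxx.
(* A largest reachable set is stalled, since any force would enlarge it. *)
case: (@arg_maxnP _ B reach (fun S => #|S|) rB) => S /andP[cS BS] maxS.
have stalled u v : ~~ can_force e L S u v.
  apply/negP=> uv; have /and3P[_ _ /eqP/setP/(_ v)] := uv.
  rewrite !inE eqxx => /andP[vS _].
  suff /maxS : reach (v |: S) by rewrite /= cardsU1 vS add1n ltnn.
  rewrite /reach (subset_trans BS (subsetUr _ _)) andbT.
  apply: connect_trans cS _; apply: connect1.
  by apply/existsP; exists u; apply/existsP; exists v; rewrite uv eqxx.
have white v : v \notin S -> l < degree e v.
  by move=> vS; have := contra (subsetP BS v) vS; rewrite inE -ltnNge.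
suff <- : S = [set: V] by [].
apply/setP=> w; rewrite inE; apply/negPn/negP=> wS.
have := white w wS; rewrite ltnNge -cL => /negP; apply.
apply: (white_degree_le_leaks se ie ae stalled) wS => v vS.
exact: leq_ltn_trans (white v vS).
Qed.

Lemma low_degree_sub_leaky_forcing_set (V : finType) (e : rel V) (l : nat)
    (A : {set V}) :
  symmetric e -> l <= #|V| -> leaky_forcing_set e l A ->
  [set v | degree e v <= l] \subset A.
Proof.
move=> se lV /forallP fA; apply/subsetP=> v; rewrite inE => dv.
(* The neighbourhood of [v] is padded to exactly [l] leaks, one vertex at a time; [l <= #|V|] leaves
   room. *)
have [L NL cL] : exists2 L : {set V}, [set w | e v w] \subset L & #|L| = l.
  have := dv; rewrite /degree; move: [set w | e v w] => N cN.
  have [k Dk] := ubnP (l - #|N|); elim: k N cN Dk => // k IHk N cN Dk.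
  case: (ltngtP #|N| l) (cN) => // [ltN|eqN] _; last by exists N.
  have /card_gt0P[x xN] : 0 < #|~: N|.
    by rewrite cardsCs setCK subn_gt0 (leq_trans ltN).
  have cxN : #|x |: N| = #|N|.+1 by move: xN; rewrite cardsU1 inE => ->.
  have [||L sL cL] := IHk (x |: N).
  - by rewrite cxN.
  - by rewrite cxN; apply: leq_trans (Dk : _ <= k); rewrite ltn_sub2l.
  by exists L => //; apply: subset_trans sL; apply: subsetUr.
have /implyP/(_ (introT eqP cL))/connectP[s ps Ds] := fA L.
apply: contraT => vA; suff : v \notin last A s by rewrite -Ds inE.
elim: s A vA ps {Ds fA} => //= S' s IHs S vS /andP[st ps]; apply: IHs => //.
(* Whiteness of [v] survives each step: a vertex forcing [v] would be a neighbour of [v], hence a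
   leak. *)
case/existsP: st => u /existsP[x /andP[/and3P[_ uL /eqP/setP Nu] /eqP->]].
have := Nu x; rewrite !inE eqxx negb_or vS andbT => /andP[_ eux].
apply: contraNneq uL => vx; apply: (subsetP NL).
by rewrite inE vx se.
Qed.

Theorem theorem4p4 (V : finType) (e : rel V) (l : nat) (B : {set V})
  (he : tree e) (hl1 : 1 <= l) (hl : l <= #|V|)
  (hB : B = [set v : V | degree e v <= l]) :
  leaky_forcing_number e l = #|B|.
Proof.
case: he => -[se ie] _ ae; rewrite /leaky_forcing_number hB.
case: arg_minnP => [|A fA minA]; first exact: leaky_forcing_setT.
apply/eqP; rewrite eqn_leq minA ?low_degree_leaky_forcing_set //=.
exact: subset_leq_card (low_degree_sub_leaky_forcing_set se hl fA).
Qed.
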